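(* Let $K$ be a field, $X=\{x_1,x_2,\ldots\}$ a finite or countable set, $F=K\langle X\rangle$ the free associative algebra, $P=K[X\times\mathbb{N}^*]$, $\sigma:P\to P$ the algebra endomorphism $x_i(j)\mapsto x_i(j+1)$, $S=P[s;\sigma]$, and let $\iota:F\to S$ be the algebra embedding $x_i\mapsto x_i(1)s$, with image $R$. Let $I\subsetneq F$ be a graded two-sided ideal and let $I'\subsetneq P$ be its letterplace analogue. Denote by $J=I'^S$ the skew analogue of $I'$ (called the skew letterplace analogue of $I$). Then $J$ is the extension to $S$ of the ideal $\iota(I)\subset R$, i.e. the two-sided ideal of $S$ generated by $\iota(I)$. Consequently there is a bijective correspondence between all graded two-sided ideals $I\subsetneq F$ and their letterplace analogues $I'$, and likewise between all such ideals $I$ and their skew letterplace analogues $J$.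
   Context: $\mathbb{N}^*=\{1,2,\ldots\}$; $P$ is the commutative polynomial ring in the variables $x_i(j)=(x_i,j)$. $S=P[s;\sigma]$ is the free left $P$-module with basis $\Sigma=\{s^i\}_{i\ge0}$ and multiplication determined by $sf=\sigma(f)s$ ($f\in P$), graded by $S_i=Ps^i$. $F=\bigoplus_iF_i$ is graded by total degree. $\Sigma$ acts on $P$ by $s^i\cdot f=\sigma^i(f)$; an ideal of $P$ is $\Sigma$-invariant if it is stable under $\sigma$. Let $\iota':F\to P$ be the injective $K$-linear map $x_{i_1}\cdots x_{i_d}\mapsto x_{i_1}(1)x_{i_2}(2)\cdots x_{i_d}(d)$, so that $\iota(f)=\iota'(f)s^i$ for $f\in F_i$. The letterplace analogue $I'$ of a graded two-sided ideal $I\subsetneq F$ is the ideal of $P$ generated by $\{\sigma^k(\iota'(f))\mid f\in I\cap F_i,\ i>0,\ k\ge0\}$. Weight grading: for a monomial $m\neq1$ of $P$ let $\mathrm{w}(m)$ be the largest $j$ such that some variable $x_i(j)$ divides $m$, and $\mathrm{w}(1)=-\infty$; $P_i$ is the $K$-span of the monomials of weight $i$. An ideal $L\subset P$ is $\mathrm{w}$-graded if $L=\sum_i(L\cap P_i)$; $I'$ is $\mathrm{w}$-graded and $\Sigma$-invariant. For a $\mathrm{w}$-graded $\Sigma$-invariant ideal $L\subsetneq P$, its skew analogue $L^S$ is the two-sided ideal of $S$ generated by $\{fs^i\mid f\in L\cap P_i,\ i\ge0\}$. *)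

(* Defs.v *)
From HB Require Import structures.
From mathcomp Require Import all_boot all_order all_algebra finmap.
From mathcomp Require Import boolp classical_sets functions.
From mathcomp Require Import monalg.

Set Implicit Arguments.
Unset Strict Implicit.
Unset Printing Implicit Defensive.

Import GRing.Theory.

Local Open Scope ring_scope.
Local Open Scope classical_set_scope.

Section Ideals.
Variable A : nzRingType.

Record ideal (L : set A) : Prop := Ideal {
  ideal0 : L 0;
  idealD : forall f g, L f -> L g -> L (f + g);
  idealMl : forall a f, L f -> L (a * f);
  idealMr : forall a f, L f -> L (f * a) }.

Definition ideal_gen (G : set A) : set A := smallest ideal G.

Lemma ideal_gen_ideal (G : set A) : ideal (ideal_gen G).
Proof.
split=> [L [idL _] | f g Gf Gg L [idL GL] | a f Gf L [idL GL] | a f Gf L [idL GL]].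
- exact: ideal0.
- by apply: idealD => //; [apply: Gf | apply: Gg].
- by apply: idealMl => //; apply: Gf.
- by apply: idealMr => //; apply: Gf.
Qed.

End Ideals.

(* The sum of the W i, when these are additive subgroups. *)
Definition set_sum (V : nmodType) (T : Type) (W : T -> set V) : set V :=
  [set f | exists2 r : seq V,
     (forall g, g \in r -> exists i, W i g) & f = \sum_(g <- r) g].

Definition graded (V : nmodType) (T : Type) (V_ : T -> set V) (L : set V) :=
  L = set_sum (fun i => L `&` V_ i).

(* The skew polynomial ring A[s; phi]: as a left A-module it is {poly A},
   with 'X^i in the role of s^i, but its product is skew_mul, for which
   s * a = phi(a) * s (lemma skew_comm). *)
Definition skew_poly (A : nzRingType) (phi : {rmorphism A -> A}) : Type :=
  {poly A}.

Section SkewPoly.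
Variables (A : nzRingType) (phi : {rmorphism A -> A}).
Local Notation S := (skew_poly phi).

HB.instance Definition _ := GRing.Lmodule.copy S {poly A}.

(* The element a s^i. *)
Definition skew_term (a : A) (i : nat) : S := a *: 'X^i.

Definition skew_mul (p q : S) : S :=
  \sum_(i < size (p : {poly A})) \sum_(j < size (q : {poly A}))
    skew_term ((p : {poly A})`_i * iter i phi (q : {poly A})`_j) (i + j).

Lemma skew_term_is_additive i :
  {morph (skew_term^~ i) : a b / a + b >-> (a + b : S)}.
Proof. by move=> a b; rewrite /skew_term scalerDl. Qed.

Lemma skew_term0 i : skew_term 0 i = 0.
Proof. exact: scale0r. Qed.

Lemma skew_poly_ind (P : S -> Prop) :
    P 0 -> (forall p q, P p -> P q -> P (p + q)) ->
  (forall a i, P (skew_term a i)) -> forall p, P p.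
Proof.
move=> P0 PD PT p; rewrite -[p](@coefK A) poly_def.
by elim/big_ind: _ => // i _; apply: PT.
Qed.

Lemma iter_phiD n : {morph iter n phi : a b / a + b}.
Proof. by elim: n => // n IHn a b /=; rewrite IHn rmorphD. Qed.

Lemma iter_phi0 n : iter n phi 0 = 0.
Proof. by elim: n => //= n ->; rewrite rmorph0. Qed.

Lemma iter_phi1 n : iter n phi 1 = 1.
Proof. by elim: n => //= n ->; rewrite rmorph1. Qed.

Lemma iter_phiM n : {morph iter n phi : a b / a * b}.
Proof. by elim: n => // n IHn a b /=; rewrite IHn rmorphM. Qed.

Lemma skew_mulw m n (p q : S) :
    (size (p : {poly A}) <= m)%N -> (size (q : {poly A}) <= n)%N ->
  skew_mul p q = \sum_(i < m) \sum_(j < n)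
    skew_term ((p : {poly A})`_i * iter i phi (q : {poly A})`_j) (i + j).
Proof.
move=> lepm leqn; rewrite /skew_mul.
rewrite [LHS](big_ord_widen m (fun i => \sum_(j < size (q : {poly A}))
  skew_term ((p : {poly A})`_i * iter i phi (q : {poly A})`_j) (i + j))) //.
rewrite big_mkcond /=; apply: eq_bigr => i _; case: ifPn => [_ | ].
  rewrite (big_ord_widen n (fun j =>
    skew_term ((p : {poly A})`_i * iter i phi (q : {poly A})`_j) (i + j))) //.
  rewrite big_mkcond /=; apply: eq_bigr => j _; case: ifPn => //.
  by rewrite -leqNgt => leqj; rewrite (nth_default _ leqj) iter_phi0 mulr0 skew_term0.
rewrite -leqNgt => lepi; rewrite big1 // => j _.
by rewrite (nth_default _ lepi) mul0r skew_term0.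
Qed.

Lemma skew_mulDl : left_distributive skew_mul +%R.
Proof.
move=> p q r; set m := maxn (size (p : {poly A})) (size (q : {poly A})).
rewrite !(@skew_mulw m (size (r : {poly A}))) ?leq_maxl ?leq_maxr //; last first.
  exact: (@size_polyD A).
rewrite -big_split; apply: eq_bigr => i _; rewrite -big_split.
apply: eq_bigr => j _ /=.
by rewrite (@coefD A) mulrDl skew_term_is_additive.
Qed.

Lemma skew_mulDr : right_distributive skew_mul +%R.
Proof.
move=> r p q; set m := maxn (size (p : {poly A})) (size (q : {poly A})).
rewrite !(@skew_mulw (size (r : {poly A})) m) ?leq_maxl ?leq_maxr //; last first.
  exact: (@size_polyD A).
rewrite -big_split; apply: eq_bigr => i _; rewrite -big_split.
apply: eq_bigr => j _ /=.
by rewrite (@coefD A) iter_phiD mulrDr skew_term_is_additive.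
Qed.

Lemma skew_mul0l p : skew_mul 0 p = 0.
Proof. by rewrite /skew_mul (@size_poly0 A) big_ord0. Qed.

Lemma skew_mul0r p : skew_mul p 0 = 0.
Proof.
by rewrite /skew_mul big1 // => i _; rewrite (@size_poly0 A) big_ord0.
Qed.

Lemma skew_mul_term a i b j :
  skew_mul (skew_term a i) (skew_term b j)
    = skew_term (a * iter i phi b) (i + j).
Proof.
have sz c k : (size (c *: 'X^k : {poly A}) <= k.+1)%N.
  by rewrite (leq_trans (size_scale_leq _ _)) // size_polyXn.
rewrite (skew_mulw (sz a i) (sz b j)) (bigD1 ord_max) //=.
rewrite (bigD1 ord_max) //= !(@coefZ A) !coefXn !eqxx !mulr1.
rewrite big1 ?addr0 => [|k nek]; last first.
  rewrite !(@coefZ A) !coefXn; case: eqP => [ek | _].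
    by case/eqP: nek; apply/val_inj.
  by rewrite mulr0 iter_phi0 mulr0 skew_term0.
rewrite big1 ?addr0 // => k nek; rewrite big1 // => l _.
rewrite !(@coefZ A) !coefXn; case: eqP => [ek | _].
  by case/eqP: nek; apply/val_inj.
by rewrite mulr0 mul0r skew_term0.
Qed.

Lemma skew_mulA : associative skew_mul.
Proof.
move=> p q r; elim/skew_poly_ind: p => [|p p' IHp IHp'|a i].
- by rewrite !skew_mul0l.
- by rewrite !skew_mulDl IHp IHp'.
elim/skew_poly_ind: q => [|q q' IHq IHq'|b j].
- by rewrite skew_mul0r !skew_mul0l skew_mul0r.
- by rewrite skew_mulDr !skew_mulDl skew_mulDr IHq IHq'.
elim/skew_poly_ind: r => [|r r' IHr IHr'|c k].
- by rewrite !skew_mul0r.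
- by rewrite !skew_mulDr IHr IHr'.
by rewrite !skew_mul_term iter_phiM mulrA addnA -iterD.
Qed.

Definition skew_one : S := skew_term 1 0.

Lemma skew_mul1l : left_id skew_one skew_mul.
Proof.
elim/skew_poly_ind=> [|p q IHp IHq|a i]; first exact: skew_mul0r.
  by rewrite skew_mulDr IHp IHq.
by rewrite skew_mul_term mul1r.
Qed.

Lemma skew_mul1r : right_id skew_one skew_mul.
Proof.
elim/skew_poly_ind=> [|p q IHp IHq|a i]; first exact: skew_mul0l.
  by rewrite skew_mulDl IHp IHq.
by rewrite skew_mul_term iter_phi1 mulr1 addn0.
Qed.

Lemma skew_one_neq0 : skew_one != 0.
Proof.
by rewrite /skew_one /skew_term (@scale1r A {poly A}) expr0; exact: (@oner_neq0 {poly A}).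
Qed.

HB.instance Definition _ := GRing.Zmodule_isNzRing.Build S
  skew_mulA skew_mul1l skew_mul1r skew_mulDl skew_mulDr skew_one_neq0.

Lemma skew_termM (a b : A) i j :
  skew_term a i * skew_term b j = skew_term (a * iter i phi b) (i + j).
Proof. exact: skew_mul_term. Qed.

Lemma skew_comm (f : A) :
  skew_term 1 1 * skew_term f 0 = skew_term (phi f) 0 * skew_term 1 1.
Proof. by rewrite !skew_termM /= mul1r mulr1. Qed.

Lemma skew_comm_fixed (a b : A) :
  phi a = a -> GRing.comm a b -> GRing.comm (skew_term a 0) (skew_term b 1).
Proof. by move=> aphi ab; rewrite /GRing.comm !skew_termM /= aphi ab. Qed.

End SkewPoly.

Arguments skew_term {A} phi a i.

Definition pos_nat : Type := {j : nat | (0 < j)%N}.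

HB.instance Definition _ := Countable.on pos_nat.

(* k |-> k + 1 *)
Definition pos_natS (k : nat) : pos_nat := exist _ k.+1 isT.

Definition pos_succ (j : pos_nat) : pos_nat := pos_natS (val j).

Notation free_alg K X := {malg K[{fmonom X}]}.
Notation lp_alg K X := {malg K[{cmonom (X * pos_nat)%type}]}.

Section Letterplace.
Variables (K : fieldType) (X : countType).

Local Notation V := (X * pos_nat)%type.
Local Notation F := (free_alg K X).
Local Notation P := (lp_alg K X).

Definition lp_var (x : X) (j : pos_nat) : P := << ucm (x, j) >>.

Definition sigma_mon (m : {cmonom V}) : P :=
  \prod_(v <- finsupp m) lp_var v.1 (pos_succ v.2) ^+ m v.

Lemma sigma_mon_is_multiplicative : mmorphism sigma_mon.
Proof.
have wide (d : {fset V}) (m : {cmonom V}) : (finsupp m `<=` d)%fset ->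
    sigma_mon m = \prod_(v <- d) lp_var v.1 (pos_succ v.2) ^+ m v.
  move=> le; rewrite /sigma_mon (big_fset_incl _ le) //= => v _.
  by rewrite -cmE_eq0 => /eqP ->.
split=> [m1 m2|]; last by rewrite /sigma_mon mdom1 big_seq_fset0.
rewrite (wide _ _ (fsubset_refl _)) mdomD.
rewrite (wide _ _ (fsubsetUl _ (finsupp m2))).
rewrite (wide _ _ (fsubsetUr (finsupp m1) _)) -big_split /=.
by apply: eq_bigr => v _; rewrite cmM exprD.
Qed.

HB.instance Definition _ :=
  isMultiplicative.Build _ _ sigma_mon sigma_mon_is_multiplicative.

Definition sigma : P -> P := mmap (@malgC {cmonom V} K) sigma_mon.
HB.instance Definition _ := GRing.RMorphism.on sigma.

Lemma sigmaC c : sigma c%:MP = c%:MP.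
Proof. exact: mmapC. Qed.

Lemma sigma_var x j : sigma (lp_var x j) = lp_var x (pos_succ j).
Proof.
rewrite /sigma /lp_var mmapU /= mpolyC1E mul1r.
by rewrite /sigma_mon mdomU big_seq_fset1 cmUU.
Qed.

Definition Sigma_invariant (L : set P) := forall f, L f -> L (sigma f).

Local Notation S := (skew_poly sigma).

Definition free_deg (d : nat) : set F :=
  [set f | forall w, w \in msupp f -> fdeg w = d].

(* None is the weight -oo of the monomial 1. *)
Definition weight (m : {cmonom V}) : option nat :=
  if m == mone then None else Some (\max_(v <- finsupp m) val v.2)%N.

Definition lp_weight (i : option nat) : set P :=
  [set f | forall m, m \in msupp f -> weight m = i].

(* x_1 ... x_d |-> x_1(1) ... x_d(d); the ordinal k counts from 0. *)
Definition lp_iota'_mon (w : {fmonom X}) : P :=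
  \prod_(k < size w) lp_var (tnth (in_tuple w) k) (pos_natS k).

Definition lp_iota' : F -> P := mmap (@malgC {cmonom V} K) lp_iota'_mon.

Definition skew_const (c : K) : S := skew_term sigma c%:MP 0.

Lemma skew_const_is_additive : additive skew_const.
Proof. by move=> a b; rewrite /skew_const rmorphB /skew_term scalerBl. Qed.

Lemma skew_const_is_multiplicative : multiplicative skew_const.
Proof.
by split=> [a b|]; rewrite /skew_const ?skew_termM ?mpolyCM ?mpolyC1E.
Qed.

HB.instance Definition _ :=
  GRing.isAdditive.Build K S skew_const skew_const_is_additive.
HB.instance Definition _ :=
  GRing.isMultiplicative.Build K S skew_const skew_const_is_multiplicative.

Definition lp_iota_mon (w : {fmonom X}) : S :=
  \prod_(x <- (w : seq X)) skew_term sigma (lp_var x (pos_natS 0)) 1.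

Lemma lp_iota_mon_is_multiplicative : mmorphism lp_iota_mon.
Proof.
by split=> [w1 w2|]; rewrite /lp_iota_mon ?fmM ?fm1 ?big_cat ?big_nil.
Qed.

HB.instance Definition _ :=
  isMultiplicative.Build _ _ lp_iota_mon lp_iota_mon_is_multiplicative.

(* The ring morphism extending x |-> x(1) s. *)
Definition lp_iota : F -> S := mmap skew_const lp_iota_mon.
HB.instance Definition _ := GRing.Additive.on lp_iota.

Lemma lp_iota_is_multiplicative : multiplicative lp_iota.
Proof.
apply: commr_mmap_is_multiplicative => g m w; rewrite /lp_iota_mon.
apply: big_ind => [|p q|x _]; [exact: commr1 | exact: commrM | ].
by apply: skew_comm_fixed (sigmaC _) _; apply: mulrC.
Qed.

HB.instance Definition _ :=
  GRing.isMultiplicative.Build F S lp_iota lp_iota_is_multiplicative.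

Lemma lp_iota_var x :
  lp_iota << fmu x >> = skew_term sigma (lp_var x (pos_natS 0)) 1.
Proof.
by rewrite /lp_iota mmapU /= rmorph1 mul1r /= /lp_iota_mon fmU big_seq1.
Qed.

Definition letterplace (I : set F) : set P :=
  ideal_gen [set g | exists i k f,
    [/\ (0 < i)%N, I f, free_deg i f & g = iter k sigma (lp_iota' f)]].

Definition weight_max (a b : option nat) : option nat :=
  match a, b with
  | Some i, Some j => Some (maxn i j)
  | None, _ => b
  | _, None => a
  end.

Lemma weightM m1 m2 : weight (mmul m1 m2) = weight_max (weight m1) (weight m2).
Proof.
rewrite /weight; have [-> | m1_n1] := eqVneq m1 mone; first by rewrite mul1m.
have [-> | m2_n1] := eqVneq m2 mone; first by rewrite mulm1 (negbTE m1_n1).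
have -> : (mmul m1 m2 == mone) = false.
  by apply/negbTE/negP => /eqP /unitm [/eqP]; rewrite (negbTE m1_n1).
rewrite mdomD; congr Some; apply/eqP; rewrite eqn_leq geq_max.
have leB (B : {fset V}) v : v \in B -> (val v.2 <= \max_(u <- B) val u.2)%N.
  by move=> vB; exact: (leq_bigmax_seq (F := fun u : V => val u.2) v vB isT).
have le (A B : {fset V}) : (A `<=` B)%fset ->
    (\max_(v <- A) val v.2 <= \max_(v <- B) val v.2)%N.
  by move=> /fsubsetP AB; apply/bigmax_leqP_seq => v /AB vB _; apply: leB.
rewrite !le ?fsubsetUl ?fsubsetUr // !andbT.
apply/bigmax_leqP_seq => v; rewrite in_fsetU leq_max => vm _.
by case/orP: vm => /leB ->; rewrite ?orbT.
Qed.

Lemma weight_ucm v : weight (ucm v) = Some (val v.2).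
Proof. by rewrite /weight -mdeg_eq0 mdegU /= mdomU big_seq_fset1. Qed.

Lemma lp_weight0 i : lp_weight i 0.
Proof. by move=> m; rewrite msupp0 in_fset0. Qed.

Lemma lp_weightD i f g : lp_weight i f -> lp_weight i g -> lp_weight i (f + g).
Proof.
move=> fi gi m /(fsubsetP (msuppD_le _ _)); rewrite in_fsetU.
by case/orP => [/fi | /gi].
Qed.

Lemma lp_weightM i j f g :
  lp_weight i f -> lp_weight j g -> lp_weight (weight_max i j) (f * g).
Proof.
by move=> fi gj m /msuppM_le [m1 [m2 [/fi <- /gj <- ->]]]; apply: weightM.
Qed.

Lemma lp_weightU c m : lp_weight (weight m) << c *g m >>.
Proof. by move=> n /(fsubsetP msuppU_le); rewrite in_fset1 => /eqP ->. Qed.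

Lemma lp_weightC c : lp_weight None c%:MP.
Proof. by have := @lp_weightU c mone; rewrite /weight eqxx. Qed.

Lemma lp_weight_sum (T : eqType) (r : seq T) (G : T -> P) i :
  (forall k, k \in r -> lp_weight i (G k)) -> lp_weight i (\sum_(k <- r) G k).
Proof.
move=> Gi; rewrite big_seq; elim/big_ind: _ => //; first exact: lp_weight0.
exact: lp_weightD.
Qed.

Lemma lp_weightZ i c f : lp_weight i f -> lp_weight i (c%:MP * f).
Proof. by move=> fi; apply: (@lp_weightM None) => //; apply: lp_weightC. Qed.

Lemma lp_weight_sigma_mon m : lp_weight (omap succn (weight m)) (sigma_mon m).
Proof.
have [n] := ubnP (mdeg m); elim: n m => // n IHn m lemn.
have [-> | m1] := eqVneq m mone.
  by rewrite mmorph1 /weight eqxx; apply: lp_weightC.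
have [v mv] : exists v, v \in finsupp m.
  apply/fset0Pn; apply: contra_neq m1 => m0; apply/eqP/cmP => v.
  by apply/eqP; rewrite cm1 cmE_eq0 m0.
have def_m : m = mmul (ucm v) (divcm m (ucm v)).
  apply/eqP/cmP => u; rewrite cmM divcmE cmU subnKC //.
  by case: eqP => // <-; rewrite lt0n cmE_neq0.
rewrite def_m mmorphM weightM weight_ucm.
have -> a b : omap succn (weight_max (Some a) b)
            = weight_max (Some a.+1) (omap succn b).
  by case: b => //= b; rewrite maxnSS.
apply: lp_weightM; last first.
  apply: IHn; move: lemn; rewrite {1}def_m mdegM mdegU; exact.
have := weight_ucm (v.1, pos_succ v.2) => /= <-.
have -> : sigma_mon (ucm v) = lp_var v.1 (pos_succ v.2).
  by rewrite /sigma_mon mdomU big_seq_fset1 cmUU.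
exact: lp_weightU.
Qed.

Lemma lp_weight_sigma i f :
  lp_weight i f -> lp_weight (omap succn i) (sigma f).
Proof.
move=> fi; rewrite /sigma mmapE; apply: lp_weight_sum => m /fi <-.
by apply: lp_weightZ; apply: lp_weight_sigma_mon.
Qed.

Lemma lp_weight_iota' d f :
  (0 < d)%N -> free_deg d f -> lp_weight (Some d) (lp_iota' f).
Proof.
move=> d0 fd; rewrite /lp_iota' mmapE; apply: lp_weight_sum => w /fd wd.
apply: lp_weightZ; rewrite /lp_iota'_mon; move: wd d0; rewrite /fdeg => <-.
move: (tnth _) => h; move: (size w) h => n h n0.
suff : lp_weight (if n is 0 then None else Some n)
  (\prod_(k < n) lp_var (h k) (pos_natS k)) by case: n n0 h.
elim: n h {n0} => [|n IHn] h; first by rewrite big_ord0; apply: lp_weightC.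
have -> : Some n.+1
    = weight_max (if n is 0 then None else Some n) (Some n.+1).
  by case: n {IHn h} => //= n; rewrite (maxn_idPr _).
rewrite big_ord_recr /=; apply: lp_weightM; first exact: IHn.
by rewrite -(weight_ucm (h ord_max, pos_natS n)); apply: lp_weightU.
Qed.

Lemma lp_weight_gen i k f : (0 < i)%N -> free_deg i f ->
  lp_weight (Some (i + k)%N) (iter k sigma (lp_iota' f)).
Proof.
move=> i0 fi; elim: k => [|k IHk]; first by rewrite addn0; apply: lp_weight_iota'.
by rewrite addnS; exact: lp_weight_sigma IHk.
Qed.

Lemma letterplace_wgraded (I : set F) : graded lp_weight (letterplace I).
Proof.
have [id0 idD idl idr] : ideal (letterplace I) := ideal_gen_ideal _.
rewrite /graded; apply/seteqP; split; last first.
  move=> _ [r rP ->]; rewrite big_seq; elim/big_ind: _ => // g /rP[i].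
  by case.
set W := (X in _ `<=` X).
have WD f g : W f -> W g -> W (f + g).
  move=> [r rP ->] [t tP ->]; exists (r ++ t); last by rewrite big_cat.
  by move=> h; rewrite mem_cat => /orP[/rP | /tP].
have W0 : W 0 by exists [::]; rewrite ?big_nil.
have W1 i f : letterplace I f -> lp_weight i f -> W f.
  move=> If fi; exists [:: f]; last by rewrite big_seq1.
  by move=> g; rewrite inE => /eqP ->; exists i.
have WM a f : W f -> W (a * f).
  move=> [r rP ->]; rewrite mulr_sumr big_seq; elim/big_ind: _ => //.
  move=> g /rP[i [Ig gi]]; rewrite [a]monalgE mulr_suml.
  elim/big_ind: _ => // m _; apply: W1; first exact: idl.
  by apply: lp_weightM gi; apply: lp_weightU.
apply: smallest_sub.
  split; [exact: W0 | exact: WD | exact: WM | move=> a f Wf].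
  by rewrite mulrC; apply: WM.
move=> g [i [k [f [i0 If fi def_g]]]]; apply: (W1 (Some (i + k)%N)).
  by apply: sub_gen_smallest; exists i, k, f; split.
by rewrite def_g; apply: lp_weight_gen.
Qed.

Lemma letterplace_proper (I : set F) : letterplace I `<` setT.
Proof.
split=> // /(_ 1 Logic.I) L1; pose M : set P := [set f | f@_mone = 0].
suff : M 1 by apply/eqP; rewrite mcoeff1 eqxx oner_eq0.
apply: L1; split.
  split=> [|f g /= f0 g0|a f /= f0|a f /= f0]; first exact: mcoeff0.
  - by rewrite /M /= mcoeffD f0 g0 addr0.
  - by rewrite /M /= rmorphM /= f0 mulr0.
  - by rewrite /M /= rmorphM /= f0 mul0r.
move=> g [i [k [f [i0 _ fi def_g]]]].
have /(_ mone) := lp_weight_gen (k := k) i0 fi; rewrite -def_g /weight eqxx.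
by move=> g1; apply/eqP; rewrite mcoeff_eq0; apply/negP => /g1.
Qed.

Lemma letterplace_invariant (I : set F) : Sigma_invariant (letterplace I).
Proof.
have [id0 idD idl idr] : ideal (letterplace I) := ideal_gen_ideal _.
move=> f /(_ [set g | letterplace I (sigma g)]); apply; split.
  split=> [|g h Lg Lh|a g Lg|a g Lg]; rewrite /mkset.
  - by rewrite rmorph0.
  - rewrite (rmorphD sigma).
    exact (idD _ _ Lg Lh).
  - rewrite (rmorphM sigma).
    exact (idl _ _ Lg).
  - rewrite (rmorphM sigma).
    exact (idr _ _ Lg).
move=> _ [i [k [g [i0 Ig gi ->]]]].
by apply: sub_gen_smallest; exists i, k.+1, g; split.
Qed.

(* Meant for the proper, w-graded and Sigma-invariant ideals L; by the three
   lemmas above L = letterplace I is always one. For such L the component of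
   weight -oo is 0, so only the finite weights contribute generators. *)
Definition skew_analogue (L : set P) : set S :=
  ideal_gen [set g | exists i f,
    [/\ L f, lp_weight (Some i) f & g = skew_term sigma f i]].

Definition skew_letterplace (I : set F) : set S :=
  skew_analogue (letterplace I).

Definition proper_graded_ideal : set (set F) :=
  [set I | [/\ ideal I, graded free_deg I & I `<` setT]].

End Letterplace.

(* Main.v *)
(* J is contained in the extension of iota(I): discarding the variables of index
   > i is a ring endomorphism t_i of P, so the f with t_i(f) s^i in the extension
   form an ideal of P, and it contains the generators of I' because
   sigma^k(iota'(g)) s^i = s^k iota(g) s^(i-d-k) when g is in I and F_d and
   d + k <= i.

   Conversely I is recovered from J.  The coefficients of the elements of J lie
   in I', which is stable under sigma.  If r : P -> F is the linear map with
   r(iota'(w)) = w for words w and r = 0 on the other monomials, the f with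
   r(P f) contained in I form an ideal containing I': for a monomial a, the
   elements r(a sigma^k(iota'(w))), w of length d, are either all 0, or all equal
   to u w v for fixed words u and v.  Hence iota'(f) in I' implies f in I. *)
From HB Require Import structures.
Require Import Defs.
From mathcomp Require Import all_boot all_order all_algebra.
From mathcomp Require Import finmap boolp.
From mathcomp Require Import classical_sets functions.
From mathcomp Require Import monalg.

Set Implicit Arguments.
Unset Strict Implicit.
Unset Printing Implicit Defensive.

Import GRing.Theory.

Local Open Scope ring_scope.
Local Open Scope classical_set_scope.

(** * Ideals of a ring and of its skew polynomial ring *)

Section IdealGen.
Variable A : nzRingType.

Lemma ideal_gen_sub (G L : set A) : ideal L -> G `<=` L -> ideal_gen G `<=` L.
Proof. exact: smallest_sub. Qed.

Lemma sub_ideal_gen (G : set A) : G `<=` ideal_gen G.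
Proof. exact: sub_gen_smallest. Qed.

Lemma ideal_sum (L : set A) (T : Type) (r : seq T) (p : pred T) (g : T -> A) :
  ideal L -> (forall i, p i -> L (g i)) -> L (\sum_(i <- r | p i) g i).
Proof.
by move=> idL Lg; apply: big_ind Lg; [apply: ideal0 | apply: idealD].
Qed.

Lemma ideal_preim (B : nzRingType) (h : {rmorphism A -> B}) (L : set B) :
  ideal L -> ideal [set f | L (h f)].
Proof.
move=> idL; split=> [|f g Lf Lg|a f Lf|a f Lf]; rewrite /= ?rmorph0.
- exact: ideal0.
- by rewrite rmorphD; apply: idealD.
- by rewrite rmorphM; apply: idealMl.
- by rewrite rmorphM; apply: Defs.idealMr.
Qed.

Variable phi : {rmorphism A -> A}.

(** The coefficients of [p * q] are sums of elements [p_i * phi^i(q_j)]; stability under [phi] is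
    what multiplication from the left requires. *)
Lemma ideal_skew_coef (L : set A) :
    ideal L -> (forall f, L f -> L (phi f)) ->
  ideal [set p : skew_poly phi | forall n, L (p : {poly A})`_n].
Proof.
move=> idL Lphi; set W := (X in ideal X).
have LphiX f n : L f -> L (iter n phi f).
  by move=> Lf; elim: n => //= n; apply: Lphi.
have W0 : W 0 by move=> n; rewrite coef0; apply: ideal0.
have WD p q : W p -> W q -> W (p + q).
  by move=> Wp Wq n; rewrite (@coefD A); apply: idealD.
have WT a i : L a -> W (skew_term phi a i).
  by move=> La n; rewrite (@coefZ A); apply: Defs.idealMr.
split=> // a f Wf; apply: (big_ind W) => // i _; apply: (big_ind W) => // j _.
  by apply: WT; apply: idealMl => //; apply/LphiX/Wf.
by apply: WT; apply: Defs.idealMr => //; apply: Wf.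
Qed.

(** Multiplying [f s^i] by [a] on the right gives [f phi^i(a) s^i], so only left multiples of [f]
    come directly from [J]; commutativity supplies the others. *)
Lemma ideal_skew_term (J : set (skew_poly phi)) i :
  ideal J -> (forall a b : A, a * b = b * a) ->
  ideal [set f | J (skew_term phi f i)].
Proof.
move=> idJ mulAC.
have Ml a f : J (skew_term phi f i) -> J (skew_term phi (a * f) i).
  have -> : skew_term phi (a * f) i = skew_term phi a 0 * skew_term phi f i.
    by rewrite skew_termM.
  exact: idealMl.
split=> [|f g Jf Jg|a f|a f] /=.
- by rewrite skew_term0; apply: ideal0.
- by rewrite skew_term_is_additive; apply: idealD.
- exact: Ml.
- by rewrite mulAC; apply: Ml.
Qed.

End IdealGen.

(** * Words and their monomials in [P] *)

(** A first letter of [s] forces [k < size z], so the prefix of [z] before [s] has length exactly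
    [k]. *)
Lemma onth_infix (T : Type) (s z : seq T) k :
    s <> [::] ->
    (forall p x, onth s p = Some x -> onth z (k + p) = Some x) ->
  exists u v, z = u ++ s ++ v /\ size u = k.
Proof.
have pre (t : seq T) : forall r,
    (forall p x, onth t p = Some x -> onth r p = Some x) ->
    exists v, r = t ++ v.
  elim: t => [|x t IHt] r tr; first by exists r.
  case: r tr => [|y r] tr; first by have := tr 0%N x erefl.
  have [p x1|v ->] := IHt r; first exact: (tr p.+1).
  by have [<-] := tr 0%N x erefl; exists v.
case: s => // x s _ sz; have szu : size (take k z) = k.
  apply/size_takel/ltnW; rewrite -onthTE.
  by have := sz 0%N x erefl; rewrite addn0 => ->.
have [p y /sz|v def_v] := pre (x :: s) (drop k z); last first.
  by exists (take k z), v; rewrite -def_v cat_take_drop.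
rewrite -{1}[z](cat_take_drop k) onth_cat szu ltnNge leq_addr /=.
by rewrite addKn.
Qed.

Section Letterplace.
Variables (K : fieldType) (X : countType).

Local Notation V := (X * pos_nat)%type.
Local Notation F := (free_alg K X).
Local Notation P := (lp_alg K X).
Local Notation sigma := (@sigma K X).
Local Notation S := (skew_poly sigma).

Lemma malgUM (M : monomType) (c1 c2 : K) (m1 m2 : M) :
  << c1 *g m1 >> * << c2 *g m2 >> = << c1 * c2 *g mmul m1 m2 >> :> {malg K[M]}.
Proof. by rewrite malgM_def fgmulUU. Qed.

(* x_1 ... x_d |-> x_1(k+1) ... x_d(k+d) *)
Fixpoint word_mon k (w : seq X) : {cmonom V} :=
  if w is x :: w' then mmul (ucm (x, pos_natS k)) (word_mon k.+1 w') else mone.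

Lemma word_mon_cat k u v :
  word_mon k (u ++ v) = mmul (word_mon k u) (word_mon (k + size u) v).
Proof.
elim: u k => [|x u IHu] k /=; first by rewrite mul1m addn0.
by rewrite IHu mulmA addSnnS.
Qed.

(** A place carries at most one letter of a word, so the exponents are 0 or 1 and determine the
    word. *)
Lemma word_monE k w x j :
  word_mon k w (x, pos_natS j)
    = (k <= j)%N && (onth w (j - k) == Some x) :> nat.
Proof.
elim: w k => [|y w IHw] k /=; first by rewrite cm1 onth0n andbF.
rewrite cmM cmU IHw -pair_eqE /= -val_eqE /= eqSS.
case: (ltngtP k j) => [ltkj|ltjk|->]; last 2 first.
- by rewrite andbF.
- by rewrite subnn andbT addn0 /= (inj_eq Some_inj).
by rewrite andbF subnS -[in RHS](prednK (n := (j - k)%N)) ?subn_gt0.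
Qed.

Lemma word_mon_inj k : injective (word_mon k).
Proof.
move=> w1 w2 e; apply: eq_from_onth => p.
have E x : (onth w1 p == Some x) = (onth w2 p == Some x).
  have := word_monE k w1 x (k + p); rewrite e word_monE leq_addr addKn /=.
  by do 2!case: (_ == _).
case def1: (onth w1 p) => [x|].
  by have := E x; rewrite def1 eqxx => /esym/eqP.
by case def2: (onth w2 p) => [x|] //; have := E x; rewrite def1 def2 eqxx.
Qed.

Lemma mmul_injl (a b m : {cmonom V}) : mmul a m = mmul b m -> a = b.
Proof.
move=> e; apply/eqP/cmP => v; move/(congr1 (fun n : {cmonom V} => n v)): e.
by rewrite !cmM => /addIn.
Qed.

(** The exponents force [s] to occur in [z] at position [k]; cancelling it shows that [a] depends
    only on the rest of [z], so any word of the same length may replace [s]. *)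
Lemma word_mon_divisor a k s z :
    s <> [::] -> mmul a (word_mon k s) = word_mon 0 z ->
  exists u v, forall w, size w = size s ->
    mmul a (word_mon k w) = word_mon 0 (u ++ w ++ v).
Proof.
move=> s_n0 e; have [p x sp|u [v [def_z szu]]] := @onth_infix _ s z k s_n0.
  (* On the left this exponent is at least 1, so on the right it cannot be 0. *)
  have := congr1 (fun m : {cmonom V} => m (x, pos_natS (k + p))) e.
  rewrite /= cmM !word_monE leq_addr addKn subn0 sp eqxx addn1 /=.
  by case: eqP.
exists u, v => w szw; move: e; rewrite def_z !word_mon_cat add0n szu szw.
rewrite [in mmul (word_mon k s) _]mulmC [in mmul (word_mon k w) _]mulmC.
by rewrite !mulmA => /mmul_injl ->.
Qed.

Lemma lp_iota'_monE (w : {fmonom X}) : lp_iota'_mon K w = << word_mon 0 w >>.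
Proof.
suff H k : \prod_(i < size w)
    lp_var K (tnth (in_tuple w) i) (pos_natS (k + i)) = << word_mon k w >>.
  by rewrite -H.
(* With [nth] and a default letter, induction on the word avoids the dependent type of [tnth]. *)
have E (t : seq X) x0 : forall k, \prod_(i < size t)
    lp_var K (nth x0 t i) (pos_natS (k + i)) = << word_mon k t >>.
  elim: t => [|x t IHt] j /=; first by rewrite big_ord0.
  rewrite big_ord_recl addn0 /=.
  under eq_bigr => i _ do rewrite /bump /= add1n -addSnnS.
  by rewrite IHt malgUM mul1r.
case: (w : seq X) => [|x s]; first by rewrite big_ord0.
by rewrite -(E _ x); apply: eq_bigr => i _; rewrite (tnth_nth x).
Qed.

Lemma sigmaM : {morph sigma : f g / f * g}.
Proof. exact: (rmorphM sigma). Qed.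

Lemma sigmaU c m : sigma << c *g m >> = c%:MP * sigma << m >>.
Proof.
have -> : << c *g m >> = c%:MP * << m >> :> P by rewrite malgUM mulr1 mul1m.
by rewrite sigmaM; congr (_ * _); apply: sigmaC.
Qed.

Lemma sigma_word_mon c k w :
  sigma << c *g word_mon k w >> = << c *g word_mon k.+1 w >>.
Proof.
rewrite sigmaU; have -> : sigma << word_mon k w >> = << word_mon k.+1 w >>.
  elim: w k => [|x w IHw] k /=; first exact: (rmorph1 sigma).
  have step i : << mmul (ucm (x, pos_natS i)) (word_mon i.+1 w) >>
      = lp_var K x (pos_natS i) * << word_mon i.+1 w >> by rewrite malgUM mulr1.
  by rewrite !step sigmaM; congr (_ * _); [exact: sigma_var | exact: IHw].
by rewrite malgUM mulr1 mul1m.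
Qed.

Lemma lp_iota'_sum (f : F) :
  lp_iota' f = \sum_(w <- msupp f) << f@_w *g word_mon 0 w >>.
Proof.
rewrite /lp_iota' mmapE; apply: eq_bigr => w _.
by rewrite lp_iota'_monE malgUM mulr1 mul1m.
Qed.

Lemma sigma_iota'_sum k (f : F) :
  iter k sigma (lp_iota' f) = \sum_(w <- msupp f) << f@_w *g word_mon k w >>.
Proof.
elim: k => [|k IHk]; first exact: lp_iota'_sum.
rewrite iterS IHk (raddf_sum sigma).
by apply: eq_bigr => w _; apply: sigma_word_mon.
Qed.

(** * Recovering [I] from its letterplace analogue *)

(** The word is picked by classical choice; [word_mon_inj] makes it unique. *)
Definition read_mon (m : {cmonom V}) : F :=
  if pselect (exists w, m = word_mon 0 w) is left e
  then << FMonom (projT1 (cid e)) >> else 0.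

Definition lp_read : P -> F := mmap (@malgC {fmonom X} K) read_mon.
HB.instance Definition _ := GRing.Additive.on lp_read.

Lemma lp_readU c w : lp_read << c *g word_mon 0 w >> = << c *g FMonom w >>.
Proof.
rewrite /lp_read mmapU /read_mon; case: pselect => [e|[]]; last by exists w.
by case: cid => v /= /word_mon_inj <-; rewrite malgUM mulr1 mul1m.
Qed.

Lemma lp_read0 c m :
  ~ (exists w, m = word_mon 0 w) -> lp_read << c *g m >> = 0.
Proof.
move=> nm; rewrite /lp_read mmapU /read_mon; case: pselect => // _.
by rewrite mulr0.
Qed.

Lemma lp_iota'K : cancel (@lp_iota' K X) lp_read.
Proof.
move=> f; rewrite lp_iota'_sum raddf_sum [RHS]monalgE.
by apply: eq_bigr => w _; rewrite /= lp_readU fmK.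
Qed.

(** All words of [f] have length [d], so [word_mon_divisor] gives the same [u] and [v] for each of
    them, or none of the products is the monomial of a word. *)
Lemma lp_read_gen c a k d (f : F) : (0 < d)%N -> free_deg d f ->
  exists p q, lp_read (<< c *g a >> * iter k sigma (lp_iota' f)) = p * f * q.
Proof.
move=> d0 fd; rewrite sigma_iota'_sum mulr_sumr raddf_sum /=.
have [[s [szs [z e]]]|nodiv] :=
    pselect (exists s, size s = d /\
      exists z, mmul a (word_mon k s) = word_mon 0 z).
  have s_n0 : s <> [::] by move=> s0; rewrite -szs s0 in d0.
  have [u [v uv]] := word_mon_divisor s_n0 e.
  exists << c *g FMonom u >>, << FMonom v >>.
  rewrite [in RHS](monalgE f) mulr_sumr mulr_suml.
  apply: eq_big_seq => w /fd wd.
  rewrite malgUM uv ?szs // lp_readU !malgUM mulr1; congr (<< _ *g _ >>).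
  by apply/eqP; rewrite fmP !fmM catA.
exists 0, 0; rewrite mulr0 big_seq big1 // => w /fd wd.
rewrite malgUM lp_read0 // => -[z e]; apply: nodiv.
by exists w; split=> //; exists z.
Qed.

Lemma letterplace_iota' (I : set F) (f : F) :
  ideal I -> letterplace I (lp_iota' f) -> I f.
Proof.
(* [lp_read] is only additive; quantifying over all multiples of [g] makes [L] an ideal. *)
move=> idI If; pose L : set P := [set g | forall a, I (lp_read (a * g))].
suff : letterplace I `<=` L.
  by move=> /(_ _ If) /(_ 1); rewrite mul1r lp_iota'K.
apply: ideal_gen_sub.
  split=> [a|g h Lg Lh a|b g Lg a|b g Lg a].
  - by rewrite mulr0 raddf0; apply: ideal0.
  - by rewrite mulrDr raddfD; apply: idealD (Lg a) (Lh a).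
  - by rewrite mulrA; apply: (Lg (a * b)).
  - by rewrite [g * b]mulrC mulrA; apply: (Lg (a * b)).
move=> _ [i [k [g [i0 Ig gi ->]]]] a.
rewrite [a]monalgE mulr_suml raddf_sum; apply: ideal_sum => // m _ /=.
have [p [q ->]] := lp_read_gen (a@_m) m k i0 gi.
by apply: Defs.idealMr => //; apply: idealMl.
Qed.

(** * Truncation to the variables of index at most [i] *)

(** The default 0 replaces the weight of the monomial 1, which is thus always kept. *)
Definition trunc_mon i (m : {cmonom V}) : P :=
  if (odflt 0%N (weight m) <= i)%N then << m >> else 0.

Lemma trunc_mon_is_multiplicative i : mmorphism (trunc_mon i).
Proof.
split=> [m1 m2|]; last by rewrite /trunc_mon /weight eqxx.
have -> : trunc_mon i (mmul m1 m2)
    = if (odflt 0%N (weight m1) <= i)%N && (odflt 0%N (weight m2) <= i)%N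
      then << mmul m1 m2 >> else 0.
  rewrite /trunc_mon weightM; case: (weight m1) (weight m2) => [j|] [k|] //=.
    by rewrite geq_max.
  by rewrite andbT.
rewrite /trunc_mon; case: (odflt _ (weight m1) <= i)%N; last by rewrite mul0r.
by case: (odflt _ (weight m2) <= i)%N; rewrite ?mulr0 //= malgUM mulr1.
Qed.

HB.instance Definition _ i :=
  isMultiplicative.Build _ _ (trunc_mon i) (trunc_mon_is_multiplicative i).

Definition trunc i : P -> P := mmap (@malgC {cmonom V} K) (trunc_mon i).
HB.instance Definition _ i := GRing.RMorphism.on (trunc i).

Lemma trunc_weight i j f :
  lp_weight (Some j) f -> trunc i f = if (j <= i)%N then f else 0.
Proof.
move=> fj; rewrite /trunc mmapE; case: ifP => leji; last first.
  rewrite big_seq big1 // => m /fj wm.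
  by rewrite /trunc_mon wm /= leji mulr0.
rewrite [RHS]monalgE; apply: eq_big_seq => m /fj wm.
by rewrite /trunc_mon wm /= leji malgUM mulr1 mul1m.
Qed.

(** * The skew letterplace analogue as an extension ideal *)

Lemma lp_iota_monE (w : {fmonom X}) :
  lp_iota_mon K w = skew_term sigma << word_mon 0 w >> (size w).
Proof.
rewrite /lp_iota_mon; elim: (w : seq X) => [|x s IHs]; first by rewrite big_nil.
rewrite big_cons IHs skew_termM /= sigma_word_mon.
by rewrite malgUM mul1r.
Qed.

Lemma lp_iota_deg d (f : F) :
  free_deg d f -> lp_iota f = skew_term sigma (lp_iota' f) d.
Proof.
move=> fd; rewrite lp_iota'_sum /lp_iota mmapE.
rewrite (big_morph (fun g => skew_term sigma g d)
           (skew_term_is_additive _ d) (skew_term0 _ d)).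
apply: eq_big_seq => w /fd wd.
rewrite lp_iota_monE /= /skew_const skew_termM /= malgUM mulr1 mul1m.
by rewrite -wd.
Qed.

Lemma skew_letterplace_sub (I : set F) :
  skew_letterplace I `<=` ideal_gen (@lp_iota K X @` I).
Proof.
set J := ideal_gen (lp_iota (X:=X) @` I).
have idJ : ideal J := ideal_gen_ideal _.
apply: ideal_gen_sub => // _ [i [f [If fi ->]]].
(* Truncation disposes of the generators of weight above [i] and fixes [f], which has weight [i]. *)
suff : letterplace I `<=` [set g | J (skew_term sigma (trunc i g) i)].
  by move/(_ _ If); rewrite /= (trunc_weight _ fi) leqnn.
apply: ideal_gen_sub.
  apply: (ideal_preim (trunc i) (L := [set g | J (skew_term sigma g i)])).
  exact: (ideal_skew_term i idJ (@mulrC P)).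
move=> _ [d [k [g [d0 Ig gd ->]]]] /=.
rewrite (trunc_weight _ (lp_weight_gen (k := k) d0 gd)).
case: ifP => ledi; last first.
  by rewrite skew_term0; apply: ideal0.
have -> : skew_term sigma (iter k sigma (lp_iota' g)) i
    = skew_term sigma 1 k * lp_iota g * skew_term sigma 1 (i - (d + k)).
  rewrite (lp_iota_deg gd) !skew_termM mul1r iter_phi1 mulr1.
  by rewrite [(k + d)%N]addnC subnKC.
apply: (Defs.idealMr idJ); apply: (idealMl idJ).
by apply: sub_ideal_gen; exists g.
Qed.

(** An element of degree 0 is a constant; if nonzero, it is a unit and [I] would be all of [F]. *)
Lemma proper_graded_deg0 (I : set F) f : proper_graded_ideal I ->
  I f -> free_deg 0 f -> f = 0.
Proof.
move=> [idI _ [_ nI]] If f0; apply: contrapT => fn0; apply: nI => g _.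
have def_f : f = (f@_mone)%:MP.
  rewrite [LHS]monalgE; case: (msuppP f mone) => [f1|nf1].
    rewrite (big_fsetD1 mone) //= big_seq big1 ?addr0 // => w.
    rewrite in_fsetD1 => /andP[w1 /f0 /fdeg_eq0I w1'].
    by rewrite w1' eqxx in w1.
  rewrite big_seq big1 ?malgC0E // => w wf.
  by rewrite -(fdeg_eq0I (f0 _ wf)) wf in nf1.
have c_n0 : f@_mone != 0.
  by apply: contra_notN fn0 => /eqP c0; rewrite def_f c0 malgC0E.
have -> : g = g * (f@_mone)^-1%:MP * f.
  by rewrite -mulrA [X in _ * (_ * X)]def_f -mpolyCM mulVf // mpolyC1E mulr1.
exact: idealMl.
Qed.

Lemma skew_letterplaceE (I : set F) : proper_graded_ideal I ->
  skew_letterplace I = ideal_gen (@lp_iota K X @` I).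
Proof.
move=> pI; apply/seteqP; split; first exact: skew_letterplace_sub.
have [idI gI _] := pI.
have idJ : ideal (skew_letterplace I) := ideal_gen_ideal _.
apply: ideal_gen_sub => // _ [f + <-]; rewrite {1}gI => -[r rP ->].
(* The generators of [letterplace I] come from positive degrees, so degree 0 is treated apart. *)
rewrite raddf_sum big_seq; apply: ideal_sum => // g /rP[[|d] [Ig gd]].
  by rewrite (proper_graded_deg0 pI Ig gd) raddf0; apply: ideal0.
apply: sub_ideal_gen; exists d.+1, (lp_iota' g); split; last exact: lp_iota_deg.
  by apply: sub_ideal_gen; exists d.+1, 0%N, g.
exact: lp_weight_iota'.
Qed.

(** * Injectivity of the correspondences *)

Lemma skew_letterplace_iota (I : set F) d f : ideal I ->
  free_deg d f -> skew_letterplace I (lp_iota f) -> I f.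
Proof.
move=> idI fd Jf; apply: letterplace_iota' => //.
have idL := ideal_gen_ideal _ : ideal (letterplace I).
have idW := ideal_skew_coef idL (@letterplace_invariant K X I).
(* The coefficient of [lp_iota f] at [s^d] is [lp_iota' f], from which [letterplace_iota'] recovers
   [f]. *)
suff sub : skew_letterplace I `<=`
    [set p : S | forall n, letterplace I (p : {poly P})`_n].
  have := sub _ Jf d; rewrite (lp_iota_deg fd) /skew_term (@coefZ P).
  by rewrite coefXn eqxx mulr1.
apply: ideal_gen_sub idW _ => _ [i [g [Lg gi ->]]] n /=.
rewrite (@coefZ P); exact: (Defs.idealMr idL).
Qed.

Lemma skew_letterplace_le (I1 I2 : set F) :
    proper_graded_ideal I1 -> proper_graded_ideal I2 ->
  skew_letterplace I1 = skew_letterplace I2 -> I1 `<=` I2.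
Proof.
move=> pI1 [idI2 _ _] eJ f I1f; have [_ gI1 _] := pI1.
move: (I1f); rewrite gI1 => -[r rP ->]; rewrite big_seq.
apply: ideal_sum => // g /rP[d [I1g gd]].
apply: (skew_letterplace_iota idI2 gd); rewrite -eJ skew_letterplaceE //.
by apply: sub_ideal_gen; exists g.
Qed.

Lemma skew_letterplace_inj :
  set_inj (@proper_graded_ideal K X) (@skew_letterplace K X).
Proof.
move=> I1 I2 /set_mem pI1 /set_mem pI2 eJ.
by apply/seteqP; split; apply: skew_letterplace_le.
Qed.

End Letterplace.

Theorem proposition7p2 (K : fieldType) (X : countType) :
  [/\ forall I : set (free_alg K X), @proper_graded_ideal K X I ->
        skew_letterplace I = ideal_gen (@lp_iota K X @` I),
      set_bij (@proper_graded_ideal K X)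
        (@letterplace K X @` @proper_graded_ideal K X)
        (@letterplace K X)
    & set_bij (@proper_graded_ideal K X)
        (@skew_letterplace K X @` @proper_graded_ideal K X)
        (@skew_letterplace K X)].
Proof.
(* The targets are images, so only injectivity has content. *)
split; [exact: skew_letterplaceE | split=> [I pI|I1 I2 pI1 pI2 eL|//]
                                 | split=> [I pI||//]].
- by exists I.
(* [J] is a function of [I'], so injectivity of the map to [J] gives that of the map to [I']. *)
- by apply: skew_letterplace_inj => //; rewrite /skew_letterplace eL.
- by exists I.
- exact: skew_letterplace_inj.
Qed.
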